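(* Let $G$ be a finite simple graph without isolated vertices, with $c$ connected components $G_1,\dots,G_c$. Then \[ \operatorname{vstab}(I(G))=\sum_{i=1}^{c}\operatorname{vstab}(I(G_i))-c+1. \]
   Context: For a finite simple graph $H$ and a field $\mathrm{k}$, the edge ideal $I(H)$ is the ideal generated by the monomials $x_ix_j$ with $\{i,j\}\in E(H)$ in the polynomial ring over $\mathrm{k}$ with variables $x_i$, $i\in V(H)$. For an ideal $I$ of a polynomial ring $S$ and $P\in\operatorname{Ass}(I)$ (associated primes of $S/I$), $v_P(I)=\min\{\deg f\mid f\in S,\ I:f=P\}$, and $v(I)=\min\{v_P(I)\mid P\in\operatorname{Ass}(I)\}$. For a homogeneous ideal $I$ the function $t\mapsto v(I^t)$ is eventually linear; $\operatorname{vstab}(I)$ denotes the smallest integer $t_0\ge1$ such that $t\mapsto v(I^t)$ is linear (of the form $at+b$) for all $t\ge t_0$. *)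

(* Defs.v *)
From HB Require Import structures.
From mathcomp Require Import all_boot all_order all_algebra.
From mathcomp Require Import mpoly.
From mathcomp Require Import boolp classical_sets.

Set Implicit Arguments.
Unset Strict Implicit.
Unset Printing Implicit Defensive.

Import GRing.Theory.
Local Open Scope ring_scope.

(* The value is 0 when A is empty. *)
Definition natmin (A : nat -> Prop) : nat :=
  xget 0%N (fun n : nat => A n /\ forall m : nat, A m -> (n <= m)%N).

(* Ideals are represented by their membership predicates, compared with =i. *)

Definition ideal_gen (R : comNzRingType) (A : R -> Prop) : {pred R} :=
  fun f => `[< exists2 s : seq (R * R),
                 (forall p, p \in s -> A p.2) &
                 f = \sum_(p <- s) p.1 * p.2 >].

Definition ideal_mul (R : comNzRingType) (I J : {pred R}) : {pred R} :=
  ideal_gen (fun h => exists f g, [/\ f \in I, g \in J & h = f * g]).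

Definition ideal_exp (R : comNzRingType) (I : {pred R}) (t : nat) : {pred R} :=
  iter t (ideal_mul I) predT.

Definition colon (R : comNzRingType) (I : {pred R}) (f : R) : {pred R} :=
  fun g => g * f \in I.

(* idealr_closed already includes properness. *)
Definition prime_ideal (R : comNzRingType) (P : {pred R}) : Prop :=
  idealr_closed P /\ prime_idealr_closed P.

Definition associated_prime (R : comNzRingType) (I P : {pred R}) : Prop :=
  prime_ideal P /\ exists f : R, colon I f =i P.

(* msize f is 1 + the total degree of f for f != 0; f = 0 never occurs below,
   as colon I 0 is the whole ring. *)
Definition local_v_number (k : fieldType) (n : nat) (I P : {pred {mpoly k[n]}})
  : nat :=
  natmin (fun d => exists2 f : {mpoly k[n]}, colon I f =i P & d = (msize f).-1).

Definition v_number (k : fieldType) (n : nat) (I : {pred {mpoly k[n]}}) : nat :=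
  natmin (fun d => exists2 P : {pred {mpoly k[n]}},
            associated_prime I P & d = local_v_number I P).

Definition linear_from (F : nat -> nat) (t0 : nat) : Prop :=
  exists a b : int, forall t : nat, (t0 <= t)%N -> (F t)%:Z = a * t%:Z + b.

Definition vstab (k : fieldType) (n : nat) (I : {pred {mpoly k[n]}}) : nat :=
  natmin (fun t0 => (1 <= t0)%N /\
            linear_from (fun t => v_number (ideal_exp I t)) t0).

(* The variable attached to the vertex x is 'X_(enum_rank x). *)
Definition edge_ideal (k : fieldType) (T : finType) (e : rel T)
  : {pred {mpoly k[#|T|]}} :=
  ideal_gen (fun m => exists x y : T,
               e x y /\ m = 'X_(enum_rank x) * 'X_(enum_rank y)).
Arguments edge_ideal k {T} e.

Definition induced (T : finType) (e : rel T) (C : {set T})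
  : rel {x : T | x \in C} :=
  fun x y => e (val x) (val y).
Arguments induced {T} e C x y : rename.

Definition components (T : finType) (e : rel T) : {set {set T}} :=
  equivalence_partition (connect e) [set: T].

(* Main.v *)
Require Import Defs.
From HB Require Import structures.
From mathcomp Require Import all_boot all_order all_algebra.
From mathcomp Require Import mpoly.
From mathcomp Require Import boolp.
From mathcomp Require Import zify.

(** The powers of an edge ideal are monomial, so everything can be read off
    exponent vectors. For an exponent vector [m] on the vertices, let [nu m] be
    the largest number of edges (with repetition) whose product divides [x^m];
    then [x^m] lies in [I^t] iff [t <= nu m]. Any polynomial [f] such that
    [I^t : f] is prime has a term [x^m] for which [I^t : x^m] is generated by
    variables ([colon_prime_term]), and conversely such a term gives an
    associated prime. Hence [v(I^(s+1))] is the least degree of an [m] with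
    [nu m = s] such that the vectors [w] with [nu (m + w) > s] are exactly those
    meeting a fixed vertex set [U] ([prime_colon s m], [v_number_eq]).

    When [G] has an edge, such an [m] is not perfectly matched, so its degree is
    at least [2s + 1]. For a connected graph consider the set of [s] for which
    [2s + 1] is attained. It is nonempty ([prime_colon_exists]): among all [m]
    with one unmatched vertex, take one whose set [U] of vertices completing it
    is largest; then [U] is everything, or one side of a bipartition. It is also
    closed under successor ([prime_colon_succ]): multiplying by the edge that
    joins the unmatched vertex to a neighbour keeps the colon prime, because an
    alternating path witnessing the failure would either avoid that edge or lead
    to its unmatched end, and both contradict the primality for [m]. Alternating
    paths enter only through the [exchange] lemma, a symmetric exchange property
    of perfectly matched vectors proved by induction, without paths.

    The number [nu] is additive over connected components, and [prime_colon]
    holds for [m] iff it holds for every restriction of [m] to a component. So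
    the degree over [G] is at least [2s + c], with equality iff every component
    attains its own minimum, and the set of [s] with equality is the sum of the
    up-closed sets of the components: it is [s >= sum of the s_i], where [s_i]
    is the threshold of [G_i] ([tight_sum]). As these lower bounds are positive
    and attained for large [s], the threshold of linearity is read off in
    [vstab_tight]: [vstab I(G_i) = s_i + 1] and
    [vstab I(G) = 1 + sum of the s_i], which is the formula. *)

Set Implicit Arguments.
Unset Strict Implicit.
Unset Printing Implicit Defensive.

(** * Matchings of vectors on the vertices of a graph *)

Section Matching.
Variables (T : finType) (e : rel T).
Implicit Types (m p q w : T -> nat) (s r t : nat).

(** The degree vectors of multisets of [s] edges. Vectors are plain functions,
    compared pointwise, so that identities between them reduce to linear
    arithmetic. *)
Inductive matched : nat -> (T -> nat) -> Prop :=
| Matched0 m : (forall z, m z = 0) -> matched 0 m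
| MatchedS s m m' x y : e x y -> matched s m ->
    (forall z, m' z = m z + (z == x) + (z == y)) -> matched s.+1 m'.

(** Membership of the monomial of exponent [m] in the [t]-th power of the edge
    ideal. *)
Definition packing t m := exists2 q, matched t q & forall z, q z <= m z.

(** Membership of the monomial of exponent [w] in the ideal generated by the
    variables in [U]. *)
Definition hits (U : {set T}) w := exists2 x, x \in U & 0 < w x.

(** The colon ideal of [I^(s+1)] by the monomial of exponent [m] is generated by
    variables. The index is shifted because [s] is then the packing number of
    [m], see [prime_colon_nu]. *)
Definition prime_colon s m :=
  exists U : {set T}, forall w, packing s.+1 (fun z => m z + w z) <-> hits U w.

Lemma matched_ext s m m' : m =1 m' -> matched s m -> matched s m'.
Proof.
move=> mm' ms; case: ms mm' => [m0 m0z mm'|{}s m0 m1 x y exy ms m1E mm'].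
  by apply: Matched0 => z; rewrite -mm'.
by apply: (MatchedS exy ms) => z; rewrite -mm'.
Qed.

Lemma sum_vertex (A : {pred T}) u : \sum_(z in A) (z == u : nat) = (u \in A).
Proof.
have [uA|uA] := boolP (u \in A).
  by rewrite (bigD1 u) //= eqxx big1 ?addn0 // => z /andP[_ /negPf->].
rewrite big1 // => z zA; case: eqP => // zu; by rewrite zu (negPf uA) in zA.
Qed.

Lemma sum_vertexT (u : T) : \sum_z (z == u : nat) = 1.
Proof. by rewrite (bigD1 u) //= eqxx big1 ?addn0 // => z /negPf->. Qed.

Lemma matched_size s m : matched s m -> \sum_z m z = s.*2.
Proof.
elim=> [{}m m0|{}s {}m m' x y _ _ IH m'E]; first by rewrite big1.
by under eq_bigr do rewrite m'E; rewrite !big_split /= !sum_vertexT IH; lia.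
Qed.

Lemma packing_size t m : packing t m -> t.*2 <= \sum_z m z.
Proof. by case=> q /matched_size <- qm; apply: leq_sum. Qed.

Lemma packing_mono t m m' : (forall z, m z <= m' z) -> packing t m -> packing t m'.
Proof. by move=> mm' [q tq qm]; exists q => // z; apply: leq_trans (mm' z). Qed.

Lemma packing_edge t m x y : e x y -> packing t m ->
  packing t.+1 (fun z => m z + (z == x) + (z == y)).
Proof.
move=> exy [q tq qm]; exists (fun z => q z + (z == x) + (z == y)).
  exact: (MatchedS exy tq).
by move=> z; rewrite !leq_add2r.
Qed.

Lemma packing_pred t m : packing t.+1 m -> packing t m.
Proof.
case=> q; move Es: t.+1 => s sq; case: sq Es => // {}s p q' x y _ sp q'E [->] qm.
by exists p => // z; apply: leq_trans (qm z); rewrite q'E; lia.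
Qed.

Lemma packing0 m : packing 0 m.
Proof. by exists (fun=> 0) => //; apply: Matched0. Qed.

Lemma packingD s t m m' : packing s m -> packing t m' ->
  packing (s + t) (fun z => m z + m' z).
Proof.
move=> [p sp pm] [q tq qm'].
exists (fun z => p z + q z); last by move=> z; apply: leq_add.
elim: sp {pm} => [{}p p0|{}s {}p p' x y exy _ IH p'E].
  by apply: matched_ext tq => z; rewrite p0.
by apply: (MatchedS exy IH) => z /=; rewrite p'E; lia.
Qed.

Hypotheses (e_sym : ssrbool.symmetric e) (e_irr : irreflexive e).

Lemma matched_edge_at s m x : matched s m -> 0 < m x ->
  exists s' m' y, [/\ s = s'.+1, e x y, matched s' m'
    & forall z, m z = m' z + (z == x) + (z == y)].
Proof.
move=> sm; elim: sm x => [{}m m0 x|{}s {}m m' a b eab sm IH m'E x];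
  first by rewrite m0.
have [->|xa] := eqVneq x a; first by exists s, m, b; split.
have [->|xb] := eqVneq x b.
  by exists s, m, a; split => // [|z]; rewrite 1?e_sym // m'E; lia.
rewrite m'E (negPf xa) (negPf xb) !addn0 => /IH[s' [m1 [y [-> exy m1s mE]]]].
exists s'.+1, (fun z => m1 z + (z == a) + (z == b)), y; split => //.
  exact: (MatchedS eab m1s).
by move=> z; rewrite m'E mE; lia.
Qed.

(** In the symmetric difference of two multisets of edges with degree vectors [p]
    and [q], follow the alternating path that leaves a vertex [u] in excess in
    [q]. If it ends at another excess vertex [v] of [q], swapping along it adds
    [u] and [v] to [p] and removes them from [q]; otherwise it ends at an excess
    vertex [v] of [p], and swapping moves [u] to [v] in [q]. The induction peels
    off one edge of each multiset, which replaces the path by its tail. *)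
Lemma exchange s r p q u : matched s p -> matched r q -> p u < q u ->
  (exists v r' q', [/\ p v + (v == u) < q v,
     matched s.+1 (fun z => p z + (z == u) + (z == v)),
     r = r'.+1, matched r' q' & forall z, q z = q' z + (z == u) + (z == v)])
  \/ (exists v q', [/\ q v < p v, matched r q'
     & forall z, q' z + (z == u) = q z + (z == v)]).
Proof.
elim: s r p q u => [|s IH] r p q u sp rq puq.
all: have [|r1 [q1 [z [rE euz q1m qE]]]] := matched_edge_at (x := u) rq; first lia.
all: have zu : z == u = false by apply: contraTF euz => /eqP->; rewrite e_irr.
all: have [pz|pz] := ltnP (p z + (z == u)) (q z).
1,3: left; exists z, r1, q1; split => //; exact: (MatchedS euz sp).
all: have [|s1 [p1 [z' [sE ezz' p1m pE]]]] := matched_edge_at (x := z) sp;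
  first by have := qE z; rewrite eqxx; lia.
all: case: sE => //= sE; subst s1.
have zz' : z' == z = false by apply: contraTF ezz' => /eqP->; rewrite e_irr.
have [q1z'|q1z'] := ltnP (q1 z') (p z').
  right; exists z', (fun x => q1 x + (x == z) + (x == z')); split.
  - have := qE z'; rewrite zz' => ->; case: eqP => [z'u|_]; last lia.
    by move: puq; rewrite qE -z'u eqxx zz'; lia.
  - by rewrite rE; apply: (MatchedS ezz' q1m).
  - by move=> x; rewrite qE; lia.
have lt1 : p1 z' < q1 z' by have := pE z'; rewrite eqxx; lia.
case: (IH _ _ _ _ p1m q1m lt1).
  case=> v [r2 [q2 [lt2 pm r1E q2m q1E]]]; left.
  exists v, r1, (fun x => q2 x + (x == z) + (x == z')); split => //.
  - by rewrite pE qE; lia.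
  - by apply: (MatchedS euz pm) => x; rewrite pE; lia.
  - by rewrite r1E; apply: (MatchedS ezz' q2m).
  - by move=> x; rewrite qE q1E; lia.
case=> v [q2 [lt2 q2m q2E]]; right.
exists v, (fun x => q2 x + (x == z) + (x == z')); split => //.
- rewrite qE pE; case: (eqVneq v u) => [vu|_]; last lia.
  by move: puq; rewrite -vu qE pE -vu eqxx; lia.
- by rewrite rE; apply: (MatchedS ezz' q2m).
- by move=> x; rewrite qE; have := q2E x; lia.
Qed.

(** Berge's augmentation: repeated exchanges either augment [p] or move [q]
    closer to [p] without changing its size, which stays larger. *)
Lemma augment s r p q : matched s p -> matched r q -> s < r ->
  exists u v, matched s.+1 (fun z => p z + (z == u) + (z == v))
    /\ forall z, p z + (z == u) + (z == v) <= maxn (p z) (q z).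
Proof.
move=> sp rq sr; have [n] := ubnP (\sum_z (q z - p z)).
elim: n q rq => // n IH q rq; rewrite ltnS => qn.
have [u puq] : exists u, p u < q u.
  apply/existsP; apply: contraPT sr; rewrite negb_exists => /forallP qp.
  suff : r.*2 <= s.*2 by lia.
  rewrite -(matched_size sp) -(matched_size rq).
  by apply: leq_sum => z _; rewrite leqNgt.
case: (exchange sp rq puq) => [[v [_ [_ [lt pm _ _ _]]]]|[v [q' [lt q'm q'E]]]].
  exists u, v; split => // z; case: (eqVneq z v) => [->|_]; first lia.
  by case: (eqVneq z u) => [->|_]; lia.
have uv : (v == u) = false by apply/eqP => vu; move: lt puq; rewrite vu; lia.
case: (IH q' q'm) => [|a [b [pm abE]]].
  apply: leq_trans qn; rewrite (bigD1 u) //= [X in _ < X](bigD1 u) //=.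
  rewrite -addSn; apply: leq_add.
    by have := q'E u; rewrite eqxx eq_sym uv; lia.
  apply: leq_sum => z /negPf zu; have := q'E z; rewrite zu.
  by case: (eqVneq z v) => [->|_]; lia.
exists a, b; split => // z; apply: leq_trans (abE z) _.
have := q'E z; case: (eqVneq z v) => [->|_]; last lia.
by rewrite uv; lia.
Qed.


Lemma prime_colon_vertex s m : prime_colon s m -> (exists x y, e x y) ->
  exists x, packing s.+1 (fun z => m z + (z == x)).
Proof.
move=> [U mU] [a [b eab]].
have [x xU _] : hits U (fun z => s.+1 * ((z == a) + (z == b))).
  apply/mU; apply: (packing_mono (m := fun z => s.+1 * ((z == a) + (z == b)))).
    by move=> z; lia.
  elim: s.+1 => [|n IH]; first exact: packing0.
  by apply: packing_mono (packing_edge eab IH) => z; lia.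
by exists x; apply/mU; exists x => //; rewrite eqxx.
Qed.

(** In degree [2s + 1], a vertex [x] of [U] completes [m] to a perfectly matched
    vector; the partner [y] of [x] is the vertex that [m] leaves unmatched. *)
Lemma near_perfect_split s m : prime_colon s m -> (exists x y, e x y) ->
    \sum_z m z = s.*2.+1 ->
  exists p x y, [/\ e x y, matched s p & forall z, m z = p z + (z == y)].
Proof.
move=> sm eT m_size.
have [x [q sq qm]] := prime_colon_vertex sm eT.
have qE z : q z = m z + (z == x).
  apply/eqP; rewrite eqn_leq qm /=; apply: contraT; rewrite -ltnNge => lt.
  suff : \sum_z q z < \sum_z (m z + (z == x)).
    by rewrite (matched_size sq) big_split /= m_size sum_vertexT; lia.
  rewrite (bigD1 z) //= [X in _ < X](bigD1 z) //= -addSn.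
  by apply: leq_add => //; apply: leq_sum.
have [|s' [p [y [[<-] exy s'p q'E]]]] := matched_edge_at (x := x) sq.
  by rewrite qE eqxx; lia.
by exists p, x, y; split => // z; have := q'E z; rewrite qE; lia.
Qed.

(** With [y] unmatched and [b] a neighbour of [y], the vector [m + b + y] works.
    If [w] misses the new vertex set [U'] and yet increases the packing number,
    then [augment] yields two vertices [u], [v] of [w] that complete
    [p + b + y], the role of [y] as one of them being excluded by the choice of
    [U']. Exchanging from [u] between [p] and [p + b + y + u + v] shows that
    [p + u + v], [p + u + y] or [p + v + y] is perfectly matched: each of these
    puts [u] or [v] into [U], a subset of [U']. *)
Lemma prime_colon_succ s m : prime_colon s m -> (exists x y, e x y) ->
    \sum_z m z = s.*2.+1 ->
  exists m', prime_colon s.+1 m' /\ \sum_z m' z = s.+1.*2.+1.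
Proof.
move=> sm eT m_size; have [p [b [y [eby sp mE]]]] := near_perfect_split sm eT m_size.
case: sm => U mU.
pose m' z := m z + (z == b) + (z == y).
have p'P : matched s.+1 (fun z => p z + (z == b) + (z == y)).
  exact: (MatchedS eby sp).
pose U' := [set x | `[< packing s.+2 (fun z => m' z + (z == x)) >]].
have U'P x : reflect (packing s.+2 (fun z => m' z + (z == x))) (x \in U').
  by rewrite inE; apply: asboolP.
have UU' x : x \in U -> x \in U'.
  move=> xU; apply/U'P.
  have /(packing_edge eby) : packing s.+1 (fun z => m z + (z == x)).
    by apply/mU; exists x => //; rewrite eqxx.
  by apply: packing_mono => z; rewrite /m'; lia.
exists m'; split; last first.
  by rewrite /m' !big_split /= m_size !sum_vertexT; lia.
exists U' => w; split; last first.
  case=> x /U'P xP wx; apply: packing_mono xP => z.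
  by case: (eqVneq z x) => [->|_]; lia.
case=> q sq qm; have [u [v [uvP uv_max]]] := augment p'P sq (ltnSn _).
have uv_le z : (z == u) + (z == v) <= (z == y) + w z.
  by have := uv_max z; have := qm z; rewrite /m' mE; lia.
(* [augment] may use the unmatched copy of [y] in place of one vertex of [w];
   the other vertex is then in [U'] by definition. *)
have hitI a b' : w a = 0 -> (forall z, (z == a) + (z == b') <= (z == y) + w z) ->
    matched s.+2 (fun z => p z + (z == b) + (z == y) + (z == a) + (z == b')) ->
    hits U' w.
  move=> wa0 ab_le abP.
  have ay : a = y.
    by apply/eqP; apply: contraT => /negPf ay; have := ab_le a; rewrite eqxx wa0 ay; lia.
  exists b'; last first.
    have := ab_le b'; rewrite eqxx; case: (eqVneq b' y) => [b'y|]; last lia.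
    by rewrite ay b'y eqxx; lia.
  apply/U'P; exists (fun z => p z + (z == b) + (z == y) + (z == a) + (z == b')) => //.
  by move=> z; rewrite /m' mE ay; lia.
have [wu0|wu] := posnP (w u); first exact: (hitI u v).
have [wv0|wv] := posnP (w v).
  apply: (hitI v u) => // [z|]; first by rewrite addnC.
  by apply: matched_ext uvP => z; lia.
have hitU a : a \in U -> a = u \/ a = v -> hits U' w.
  by move=> aU [] E; exists a; rewrite ?E // -?E; apply: UU'.
have lt_u : p u < p u + (u == b) + (u == y) + (u == u) + (u == v).
  by rewrite eqxx; lia.
case: (exchange sp uvP lt_u); last by case=> x [q' [lt]]; lia.
case=> x [_ [q' [lt puxP [<-] q'P q'E]]].
have [xv|xv] := eqVneq x v.
  have [a aU] : hits U (fun z => (z == u) + (z == v)).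
    apply/mU; exists (fun z => p z + (z == u) + (z == x)) => // z.
    by rewrite mE xv; clear lt lt_u; lia.
  move=> a_uv; apply: (hitU a) => //.
  by move: a_uv; do 2![case: eqP => ?; auto].
have [xy|xy] := eqVneq x y.
  have [a aU] : hits U (fun z => (z == u : nat)).
    apply/mU; exists (fun z => p z + (z == u) + (z == x)) => // z.
    by rewrite mE xy; clear lt lt_u; lia.
  by case: eqP => // au _; apply: (hitU a) => //; left.
have xb : x = b.
  by apply/eqP; apply: contraLR lt => xb; rewrite (negPf xv) (negPf xy) (negPf xb); lia.
have [a aU] : hits U (fun z => (z == v : nat)).
  apply/mU; exists q' => // z; have := q'E z.
  by rewrite mE xb; clear lt lt_u; lia.
by case: eqP => // av _; apply: (hitU a) => //; right.
Qed.

Lemma prime_colon_unmatched s m : prime_colon s m -> ~ packing s.+1 m.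
Proof.
move=> [U mU] sm; have [] : hits U (fun=> 0); last by [].
by apply/mU; apply: packing_mono sm => z; lia.
Qed.

Lemma prime_colon_size s m : prime_colon s m -> (exists x y, e x y) -> s.*2 < \sum_z m z.
Proof.
move=> sm eT; have [x /packing_size] := prime_colon_vertex sm eT.
by rewrite big_split /= sum_vertexT; lia.
Qed.

Lemma matched_half (X : {set T}) s q :
  (forall x y, e x y -> (x \in X) (+) (y \in X)) -> matched s q ->
  \sum_(z in X) q z = s.
Proof.
move=> bip; elim=> [m m0|{}s m m' x y exy _ IH m'E]; first by rewrite big1.
under eq_bigr do rewrite m'E; rewrite !big_split /= !sum_vertex IH.
by move: (bip _ _ exy); do 2![case: (_ \in X)] => //=; lia.
Qed.

Lemma connect_closed (A : {pred T}) : (forall x y, connect e x y) ->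
  (forall x y, x \in A -> e x y -> y \in A) -> forall x y, x \in A -> y \in A.
Proof.
move=> conn Acl x y xA; have /connectP[c] := conn x y.
elim: c x xA => [|z c IH] x xA /=; first by move=> _ ->.
move=> /andP[exz zc] yE.
by apply: (IH z) => //; apply: Acl exz.
Qed.

(** Adding an edge to the matched part [p] cannot shrink [reach s p y], the set of
    vertices that complete [p + y]. For a largest such set [X] this forces
    [N(N(X))] to be contained in [X]. By connectedness, either [X] is the whole
    vertex set, and primality is a degree count, or [X] is one side of a
    bipartition; then each edge uses one unit of weight on [X], while [m] has
    only [s] of them, so a vector off [X] cannot help. *)
Lemma prime_colon_exists : (forall x y, connect e x y) -> (exists x y, e x y) ->
  exists s m, prime_colon s m /\ \sum_z m z = s.*2.+1.
Proof.
move=> conn [x0 [y0 exy0]].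
pose reach s p y := [set x | `[< packing s.+1 (fun z => p z + (z == y) + (z == x)) >]].
have reachP s p y x : reflect (packing s.+1 (fun z => p z + (z == y) + (z == x)))
    (x \in reach s p y) by rewrite inE; apply: asboolP.
pose R X := `[< exists s p y, matched s p /\ X = reach s p y >].
have R0 : R (reach 0 (fun=> 0) x0).
  by apply/asboolP; exists 0, (fun=> 0), x0; split => //; apply: Matched0.
case: (arg_maxnP (fun X : {set T} => #|X|) R0) => X /asboolP[s [p [y [sp XE]]]] Xmax.
have enbr x : exists z, e x z.
  have [->|xx0] := eqVneq x x0; first by exists y0.
  have /connectP[[|z c] /= ] := conn x x0; first by move=> _ x0x; rewrite x0x eqxx in xx0.
  by case/andP; exists z.
have closed2 a b c : a \in X -> e a b -> e b c -> c \in X.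
  move=> aX eab ebc.
  have p'P : matched s.+1 (fun z => p z + (z == a) + (z == b)).
    exact: (MatchedS eab sp).
  have sub : X \subset reach s.+1 (fun z => p z + (z == a) + (z == b)) y.
    apply/subsetP => x; rewrite XE => /reachP /(packing_edge eab) xP.
    by apply/reachP; apply: packing_mono xP => z; lia.
  have /eqP -> : X == reach s.+1 (fun z => p z + (z == a) + (z == b)) y.
    rewrite eqEcard sub; apply: Xmax; apply/asboolP.
    by exists s.+1, (fun z => p z + (z == a) + (z == b)), y.
  move: aX; rewrite XE => /reachP /(packing_edge ebc) aP.
  by apply/reachP; apply: packing_mono aP => z; lia.
have nbrX x : e y x -> x \in X.
  move=> eyx; rewrite XE; apply/reachP.
  by exists (fun z => p z + (z == y) + (z == x)) => //; apply: (MatchedS eyx sp).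
exists s, (fun z => p z + (z == y)); split; last first.
  by rewrite big_split /= (matched_size sp) sum_vertexT; lia.
exists X => w; split; last first.
  case=> x; rewrite XE => /reachP xP wx; apply: packing_mono xP => z.
  by case: (eqVneq z x) => [->|_]; lia.
have [XT|] := eqVneq X [set: T].
  move=> /packing_size; rewrite !big_split /= (matched_size sp) sum_vertexT => lt.
  have [z wz] : exists z, 0 < w z.
    apply/existsP; apply: contraLR lt; rewrite negb_exists => /forallP w0.
    by rewrite [\sum_z w z]big1 => [|z _]; [lia|have := w0 z; lia].
  by exists z => //; rewrite XT inE.
rewrite -subTset => /subsetPn[z0 _ z0X].
have indep a b : e a b -> a \in X -> b \notin X.
  move=> eab aX; apply: contra z0X => bX.
  pose A : {pred T} := [pred x | (x \in X) && [exists t, (t \in X) && e t x]].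
  suff : z0 \in A by case/andP.
  apply: (@connect_closed A conn _ a).
    move=> x x' /andP[xX /existsP[t /andP[tX etx]]] exx'.
    rewrite inE (closed2 t x) //=; apply/existsP; exists x; by rewrite xX.
  by rewrite inE aX /=; apply/existsP; exists b; rewrite bX e_sym.
have cover a b : e a b -> (a \in X) || (b \in X).
  move=> eab; case: (boolP (a \in X)) => //= aX.
  pose A : {pred T} := [pred x | (x \in X) || [exists t, (t \in X) && e t x]].
  have [z eyz] := enbr y.
  have : a \in A.
    apply: (@connect_closed A conn _ z); last by rewrite inE (nbrX z).
    move=> x x' /orP[xX|/existsP[t /andP[tX etx]]] exx'; rewrite inE.
      by apply/orP; right; apply/existsP; exists x; rewrite xX.
    by rewrite (closed2 t x).
  rewrite inE (negPf aX) /= => /existsP[t /andP[tX eta]].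
  exact: (closed2 t a).
have bip a b : e a b -> (a \in X) (+) (b \in X).
  move=> eab; have := cover _ _ eab; have := indep a b eab.
  by have := @indep b a; rewrite e_sym eab; do 2![case: (_ \in X)] => //= /(_ isT isT).
have yX : (y \in X) = false.
  have [z eyz] := enbr y; apply/negbTE; apply: (indep z); first by rewrite e_sym.
  exact: nbrX.
case=> q sq qm; apply: contrapT => no_hit.
have : \sum_(z in X) q z <= \sum_(z in X) (p z + (z == y)).
  apply: leq_sum => z zX; apply: leq_trans (qm z) _.
  suff : w z = 0 by lia.
  by apply: contrapT => wz; apply: no_hit; exists z => //; lia.
by rewrite big_split /= sum_vertex (matched_half bip sq) (matched_half bip sp) yX; lia.
Qed.

(** The bound on [t] only makes the maximum finite: see [packing_size]. *)
Definition nu m := \max_(t < (\sum_z m z).+1 | `[< packing t m >]) (t : nat).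

Lemma nuP t m : packing t m <-> t <= nu m.
Proof.
split=> [tm|].
  have lt : t < (\sum_z m z).+1 by have := packing_size tm; lia.
  by apply: (leq_bigmax_cond (Ordinal lt)); apply/asboolP.
have : packing (nu m) m.
  apply: (big_ind (fun t => packing t m)); first exact: packing0.
    by move=> x y xm ym; rewrite /maxn; case: ifP.
  by move=> i /asboolP.
elim: (nu m) => [|n IH] nm; first by rewrite leqn0 => /eqP->.
by rewrite leq_eqVlt => /orP[/eqP->//|]; apply: IH; apply: packing_pred.
Qed.

Lemma nu_mono m m' : (forall z, m z <= m' z) -> nu m <= nu m'.
Proof. by move=> mm'; apply/nuP; apply: packing_mono mm' _; apply/nuP. Qed.

Lemma prime_colon_nu s m : prime_colon s m -> (exists x y, e x y) -> nu m = s.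
Proof.
move=> sm eT; apply/eqP; rewrite eqn_leq leqNgt; apply/andP; split.
  by apply/negP => /nuP; apply: prime_colon_unmatched.
apply/nuP; have [x [q sq qm]] := prime_colon_vertex sm eT.
have [qx|qx] := posnP (q x).
  apply: packing_pred; exists q => // z; have := qm z.
  by case: (eqVneq z x) => [->|]; lia.
have [s' [q' [y [[<-] _ sq' qE]]]] := matched_edge_at sq qx.
by exists q' => // z; have := qm z; rewrite qE; lia.
Qed.

Lemma prime_colon_nuP m : prime_colon (nu m) m <->
  exists U, forall w, nu m < nu (fun z => m z + w z) <-> hits U w.
Proof. by split=> -[U mU]; exists U => w; rewrite -mU; split=> /nuP. Qed.

(** With [c] the number of components, [2s + c] is the least conceivable value of
    the v-number of [I^(s+1)]: this is the set of [s] attaining it. *)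
Definition tight c s := exists m, prime_colon s m /\ \sum_z m z = s.*2 + c.

End Matching.

(** * Minima of sets of natural numbers *)

Section NatMin.

Lemma natminP (A : nat -> Prop) d : A d -> A (natmin A) /\ natmin A <= d.
Proof.
move=> Ad; have exA : exists n, `[< A n >] by exists d; apply/asboolP.
have [n nA nmin] := ex_minnP exA.
have minA : exists x, (fun n : nat => A n /\ forall m, A m -> n <= m) x.
  by exists n; split=> [|m mA]; [apply/asboolP | apply: nmin; apply/asboolP].
by have [? lt] := classical_sets.xgetPex 0 minA; split => //; apply: lt.
Qed.

Lemma natmin_eq (A : nat -> Prop) d : A d -> (forall n, A n -> d <= n) -> natmin A = d.
Proof.
by move=> Ad dmin; have [An le] := natminP Ad; apply/eqP; rewrite eqn_leq le dmin.
Qed.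

(** A nonzero minimum is attained: [0] is the default value on the empty set. *)
Lemma natmin_pos (A : nat -> Prop) d : 0 < d -> natmin A = d -> A d.
Proof.
move=> d0 dE; have [[x Ax]|A0] := pselect (exists x, A x).
  by rewrite -dE; have [] := natminP Ax.
move: d0; rewrite -dE /natmin classical_sets.xgetPN // => x [Ax _].
by apply: A0; exists x.
Qed.

End NatMin.

(** * Powers of edge ideals and their colon ideals *)

Section Algebra.
Local Open Scope ring_scope.
Import GRing.Theory.

Section IdealGen.
Variables (R : comNzRingType) (A : R -> Prop).

Lemma ideal_gen_mem f : A f -> f \in ideal_gen A.
Proof.
move=> Af; apply/asboolP; exists [:: (1, f)]; last by rewrite big_seq1 mul1r.
by move=> p; rewrite inE => /eqP->.
Qed.

Lemma ideal_gen0 : 0 \in ideal_gen A.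
Proof. by apply/asboolP; exists [::] => //; rewrite big_nil. Qed.

Lemma ideal_genD f g : f \in ideal_gen A -> g \in ideal_gen A -> f + g \in ideal_gen A.
Proof.
move=> /asboolP[s sA ->] /asboolP[s' sA' ->]; apply/asboolP; exists (s ++ s').
  by move=> p; rewrite mem_cat => /orP[/sA|/sA'].
by rewrite big_cat.
Qed.

Lemma ideal_genM f g : g \in ideal_gen A -> f * g \in ideal_gen A.
Proof.
move=> /asboolP[s sA ->]; apply/asboolP; exists [seq (f * p.1, p.2) | p <- s].
  by move=> p /mapP[q /sA Aq ->].
by rewrite mulr_sumr big_map; apply: eq_bigr => p _; rewrite mulrA.
Qed.

End IdealGen.

Variable (k : fieldType).

Lemma msuppM_ex n (f g : {mpoly k[n]}) m : m \in msupp (f * g) ->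
  exists m1 m2, [/\ m1 \in msupp f, m2 \in msupp g & m = (m1 + m2)%MM].
Proof. by move=> /msuppM_le /allpairsP[[m1 m2] [? ? ->]]; exists m1, m2. Qed.

Lemma msupp_sum_ex n (I : eqType) (s : seq I) (F : I -> {mpoly k[n]}) m :
  m \in msupp (\sum_(i <- s) F i) -> exists2 i, i \in s & m \in msupp (F i).
Proof.
by move=> /msupp_sum_le /flattenP[_ /mapP[i + ->]]; rewrite filter_predT; exists i.
Qed.

Section EdgeIdeal.
Variables (T : finType) (e : rel T).
Local Notation n := #|T|.
Local Notation I := (edge_ideal k e).
Implicit Types (f g : {mpoly k[n]}) (m : 'X_{1..n}) (w : T -> nat).

Definition vexp m : T -> nat := fun x => m (enum_rank x).
Definition vmon w : 'X_{1..n} := [multinom w (enum_val i) | i < n].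

Lemma vmonK w : vexp (vmon w) =1 w.
Proof. by move=> x; rewrite /vexp mnmE enum_rankK. Qed.

Lemma vexpD m m' x : vexp (m + m')%MM x = (vexp m x + vexp m' x)%N.
Proof. exact: mnmDE. Qed.

Lemma vexp1 x z : vexp U_(enum_rank x)%MM z = (z == x).
Proof. by rewrite /vexp mnm1E (inj_eq enum_rank_inj) eq_sym. Qed.

Lemma vexp_sum m : (\sum_x vexp m x)%N = mdeg m.
Proof.
by rewrite mdegE (reindex (@enum_rank T)) //; apply: onW_bij; apply: enum_rank_bij.
Qed.

Lemma vmon_mdeg w : mdeg (vmon w) = (\sum_x w x)%N.
Proof. by rewrite -vexp_sum; apply: eq_bigr => x _; rewrite vmonK. Qed.

Lemma vexp_le m m' : (forall x, vexp m x <= vexp m' x)%N -> exists m1, m' = (m1 + m)%MM.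
Proof.
move=> le; exists (m' - m)%MM; apply/mnmP => i; rewrite mnmDE mnmBE subnK //.
by have := le (enum_val i); rewrite /vexp enum_valK.
Qed.

(** A power of an edge ideal is spanned by the monomials that it contains. *)
Lemma edge_ideal_expP t f : reflect {in msupp f, forall m, packing e t (vexp m)}
  (f \in ideal_exp I t).
Proof.
apply/(iffP idP).
  elim: t f => [f _ m _|t IH f]; first exact: packing0.
  move=> /asboolP[s sA ->] m /msupp_sum_ex[[c h] /sA /= [g [h' [gI h'I ->]]]].
  move=> /msuppM_ex[m1 [m2 [_ /msuppM_ex[m3 [m4 [m3g m4h ->]]] ->]]].
  have m4P := IH _ h'I _ m4h.
  move: gI m3g => /asboolP[s' sA' ->] /msupp_sum_ex[[c' h''] /sA' /= [x [y [exy ->]]]].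
  rewrite -mpolyXD => /msuppM_ex[m5 [m6 [_ + ->]]].
  rewrite msuppX inE => /eqP->.
  by apply: packing_mono (packing_edge exy m4P) => z; rewrite !vexpD !vexp1; lia.
elim: t f => [//|t IH] f fP; rewrite [f]mpolyE big_seq.
apply: (big_ind (fun g => g \in ideal_exp I t.+1)).
- exact: ideal_gen0.
- by move=> *; apply: ideal_genD.
move=> m /fP[q]; move Es: t.+1 => s sq; case: sq Es => // {}s p q' x y exy sp q'E [st] qm.
subst s; have [m1 ->] : exists m1,
    m = (m1 + (U_(enum_rank x) + U_(enum_rank y) + vmon p))%MM.
  by apply: vexp_le => z; rewrite !vexpD !vexp1 vmonK; have := qm z; rewrite q'E; lia.
rewrite mpolyXD scalerAl; apply: ideal_genM; apply: ideal_gen_mem.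
exists ('X_(enum_rank x) * 'X_(enum_rank y)), 'X_[vmon p]; split.
- by apply: ideal_gen_mem; exists x, y.
- apply: IH => m'; rewrite msuppX inE => /eqP->.
  by exists p => // z; rewrite vmonK.
- by rewrite !mpolyXD.
Qed.

(** The ideal generated by the variables in [U], described by supports. *)
Definition hit_ideal (U : {set T}) : {pred {mpoly k[n]}} :=
  fun f => all (fun m => [exists x, (x \in U) && (0 < vexp m x)%N]) (msupp f).

Lemma hitsP (U : {set T}) w :
  reflect (hits U w) [exists x, (x \in U) && (0 < w x)%N].
Proof.
by apply: (iffP existsP) => [[x /andP[]]|[x xU wx]]; exists x; rewrite ?xU.
Qed.

Lemma hit_idealP U f :
  reflect {in msupp f, forall m, hits U (vexp m)} (f \in hit_ideal U).
Proof. by apply: (iffP allP) => fP m /fP /hitsP. Qed.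

(** The substitution of [0] for the variables in [U]; its kernel is [hit_ideal U],
    which is therefore prime. *)
Definition kill (U : {set T}) : {mpoly k[n]} -> {mpoly k[n]} :=
  mmap (@mpolyC n k)
    (fun i : 'I_n => if enum_val i \in U then 0 else 'X_i : {mpoly k[n]}).

Lemma killX U m : kill U 'X_[m] =
  if [exists x, (x \in U) && (0 < vexp m x)%N] then 0 else 'X_[m].
Proof.
rewrite /kill mmapX /mmap1; case: hitsP => [[x xU mx]|no_hit].
  by rewrite (bigD1 (enum_rank x)) //= enum_rankK xU expr0n eqn0Ngt mx mul0r.
rewrite mpolyXE_id; apply: eq_bigr => i _; case: ifP => // iU.
suff -> : m i = 0%N by rewrite !expr0.
apply: contrapT => mi; apply: no_hit; exists (enum_val i) => //.
by rewrite /vexp enum_valK lt0n; apply/eqP.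
Qed.

Lemma mcoeff_kill U f m : (kill U f)@_m =
  if [exists x, (x \in U) && (0 < vexp m x)%N] then 0 else f@_m.
Proof.
elim/mpolyind: f => [|c m' f _ _ IH]; first by rewrite /kill mmap0 mcoeff0 if_same.
rewrite /kill mmapD mcoeffD -/(kill U f) IH mmapZ -/(kill U _) killX.
rewrite mul_mpolyC mcoeffD !mcoeffZ mcoeffX.
case: (eqVneq m' m) => [->|m'm].
  by case: ifP => _; rewrite ?mcoeff0 ?mulr0 ?addr0 ?mcoeffX ?eqxx.
rewrite mulr0 add0r; case: ifP => _; rewrite ?mcoeff0 ?mulr0 ?add0r //.
by rewrite mcoeffX (negPf m'm) mulr0 add0r.
Qed.

Lemma kill_eq0 U f : (f \in hit_ideal U) = (kill U f == 0).
Proof.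
apply/hit_idealP/eqP => [fU|/mpolyP kf m].
  apply/mpolyP => m; rewrite mcoeff_kill mcoeff0; case: hitsP => // no_hit.
  by apply: memN_msupp_eq0; apply/negP => /fU.
have := kf m; rewrite mcoeff_kill mcoeff0 mcoeff_msupp.
by case: hitsP => // _ ->; rewrite eqxx.
Qed.

Lemma hit_ideal_prime U : prime_ideal (hit_ideal U).
Proof.
split; last first.
  by move=> f g; rewrite !kill_eq0 /kill rmorphM mulf_eq0.
split=> [||f g h]; rewrite ?kill_eq0 /kill ?rmorph0 ?rmorph1 ?oner_eq0 //.
by rewrite rmorphD rmorphM /= => /eqP-> /eqP->; rewrite mulr0 addr0.
Qed.

Lemma colon_vmon t w (U : {set T}) :
  (forall v, packing e t (fun z => w z + v z)%N <-> hits U v) ->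
  colon (ideal_exp I t) 'X_[vmon w] =i hit_ideal U.
Proof.
move=> wU f; apply/edge_ideal_expP/hit_idealP => [fP m mf|fU m].
  apply/wU; have /fP : (vmon w + m)%MM \in msupp (f * 'X_[vmon w]).
    by rewrite mcoeff_msupp mcoeffMX -mcoeff_msupp.
  by apply: packing_mono => z; rewrite vexpD vmonK.
move=> /msuppM_ex[m1 [m2 [/fU /wU m1P + ->]]]; rewrite msuppX inE => /eqP->.
by apply: packing_mono m1P => z; rewrite vexpD vmonK addnC.
Qed.

(** Let [U] be the set of the variables in [P]. By primality a monomial is in [P]
    iff it meets [U]. If no term of [f] worked, every term [m] would have a
    multiplier [F m] off [U] sending it into the ideal; the product of these
    multipliers sends all of [f] into the ideal, hence lies in [P], although it
    avoids [U]. *)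
Lemma colon_prime_term t f P : prime_ideal P -> colon (ideal_exp I t) f =i P ->
  exists2 w, exists U : {set T}, forall v,
      packing e t (fun z => w z + v z)%N <-> hits U v
    & (\sum_x w x <= (msize f).-1)%N.
Proof.
move=> [[P0 P1 Padd] Pmul] fP.
pose U := [set x | 'X_(enum_rank x) \in P].
have PX m : 'X_[m] \in P <-> hits U (vexp m).
  split=> [|[x]]; last first.
    rewrite inE => xP mx; have [m' ->] : exists m', m = (m' + U_(enum_rank x))%MM.
      by apply: vexp_le => z; rewrite vexp1; case: eqP => // ->.
    by rewrite mpolyXD -[_ * _]addr0; apply: Padd.
  have [N] := ubnP (mdeg m); elim: N m => // N IH m mN mP.
  have [m0|] := eqVneq m 0%MM; first by rewrite m0 mpolyX0 (negPf P1) in mP.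
  rewrite -mdeg_eq0 -vexp_sum sum_nat_eq0 => /forallPn[x /=].
  rewrite -lt0n => mx.
  have [m' mE] : exists m', m = (m' + U_(enum_rank x))%MM.
    by apply: vexp_le => z; rewrite vexp1; case: eqP => // ->.
  move: mP; rewrite mE mpolyXD => /Pmul /orP[m'P|xP].
    have [|y yU m'y] := IH m' _ m'P; first by move: mN; rewrite mE mdegD mdeg1; lia.
    by exists y => //; rewrite vexpD; lia.
  by exists x; rewrite ?inE // -mE.
have colonX m' : 'X_[m'] \in P <->
    {in msupp f, forall m, packing e t (fun z => vexp m' z + vexp m z)%N}.
  rewrite -fP; split=> [/edge_ideal_expP XfP m mf|XfP].
    have : (m' + m)%MM \in msupp ('X_[m'] * f).
      by rewrite mulrC mcoeff_msupp mcoeffMX -mcoeff_msupp.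
    by move=> /XfP; apply: packing_mono => z; rewrite vexpD.
  apply/edge_ideal_expP => _ /msuppM_ex[m1 [m2 [+ /XfP m2P ->]]].
  rewrite msuppX inE => /eqP->; apply: packing_mono m2P => z.
  by rewrite vexpD.
have [m mf mP] : exists2 m, m \in msupp f &
    forall v, packing e t (fun z => vexp m z + v z)%N -> hits U v.
  apply: contrapT => no_m.
  have /boolp.choice[F FP] m : exists v, m \in msupp f ->
      packing e t (fun z => vexp m z + v z)%N /\ ~ hits U v.
    have [mf|] := boolP (m \in msupp f); last by exists (fun=> 0%N).
    apply: contrapT => no_v; apply: no_m; exists m => // v vP.
    by apply: contrapT => vU; apply: no_v; exists v.
  have : 'X_[\sum_(m <- msupp f) vmon (F m)] \in P.
    apply/colonX => m mf; have [mP _] := FP m mf.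
    apply: packing_mono mP => z; rewrite addnC leq_add2r /vexp mnm_sumE.
    by rewrite (big_rem m) //= -/(vexp _ _) vmonK leq_addr.
  move=> /PX[x xU]; rewrite /vexp mnm_sumE lt0n sum_nat_seq_neq0 => /hasP[m mf /=].
  rewrite -lt0n -/(vexp _ _) vmonK => Fx.
  by have [_ []] := FP m mf; exists x.
exists (vexp m); last by rewrite vexp_sum; have := msize_mdeg_lt mf; lia.
exists U => v; split=> [|vU]; first exact: mP.
have /colonX /(_ m mf) : 'X_[vmon v] \in P.
  by apply/PX; case: vU => x xU vx; exists x; rewrite ?vmonK.
by apply: packing_mono => z; rewrite vmonK addnC.
Qed.

End EdgeIdeal.
End Algebra.

(** * Decomposition over the connected components *)

Lemma ltn_sum_in (I : finType) (A : {pred I}) (F G : I -> nat) i :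
  i \in A -> F i < G i -> (forall j, j \in A -> F j <= G j) ->
  \sum_(j in A) F j < \sum_(j in A) G j.
Proof.
move=> iA lt le; rewrite (bigD1 i) //= [X in _ < X](bigD1 i) //= -addSn.
by apply: leq_add => //; apply: leq_sum => j /andP[/le].
Qed.

Section Components.
Variables (T : finType) (e : rel T).
Hypotheses (e_sym : ssrbool.symmetric e) (e_irr : irreflexive e).
Hypothesis e_nbr : forall x, exists y, e x y.
Local Notation P := (components e).
Implicit Types (C : {set T}) (m w : T -> nat).

Definition restrict C w : {x | x \in C} -> nat := fun x => w (val x).
Arguments restrict : clear implicits.

Definition extend C (q : {x | x \in C} -> nat) : T -> nat :=
  fun z => oapp q 0 (insub z).

Lemma extend_val C (q : {x | x \in C} -> nat) x : extend q (val x) = q x.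
Proof. by rewrite /extend valK. Qed.

Lemma extend_out C (q : {x | x \in C} -> nat) z : z \notin C -> extend q z = 0.
Proof. by move=> zC; rewrite /extend insubN. Qed.

Lemma components_partition : partition P [set: T].
Proof.
apply: equivalence_partitionP => x y z _ _ _; split=> [|xy]; first exact: connect0.
exact: (same_connect (sym_connect_sym e_sym) xy).
Qed.

Lemma component_trivIset : trivIset P.
Proof. by have /and3P[] := components_partition. Qed.

Lemma mem_component x : x \in pblock P x.
Proof. by rewrite mem_pblock (cover_partition components_partition) inE. Qed.

Lemma component_mem x : pblock P x \in P.
Proof. by rewrite pblock_mem // (cover_partition components_partition) inE. Qed.

Lemma componentE C x : C \in P -> x \in C -> pblock P x = C.
Proof. exact: (def_pblock component_trivIset). Qed.

Lemma component_connect C x y : C \in P -> x \in C -> (y \in C) = connect e x y.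
Proof.
case/imsetP=> x0 _ ->; rewrite !inE /= => x0x.
exact: (same_connect (sym_connect_sym e_sym) x0x).
Qed.

Lemma component_closed C x y : C \in P -> e x y -> (x \in C) = (y \in C).
Proof.
move=> CP exy; apply/idP/idP => xC; rewrite (component_connect _ CP xC).
  exact: connect1.
by apply: connect1; rewrite e_sym.
Qed.

Lemma component_edge C : C \in P -> exists x y, induced e C x y.
Proof.
move=> CP; have /and3P[_ _ P0] := components_partition.
have /set0Pn[x xC] : C != set0 by apply: contraNneq P0 => <-.
have [y exy] := e_nbr x; have yC : y \in C by rewrite -(component_closed CP exy).
by exists (Sub x xC), (Sub y yC).
Qed.

Lemma induced_connect C : C \in P -> forall x y, connect (induced e C) x y.
Proof.
move=> CP x y; have := valP y; rewrite (component_connect _ CP (valP x)).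
case/connectP=> c; elim: c x => [|z c IH] x /=.
  by move=> _ /val_inj ->; apply: connect0.
case/andP=> exz zc yE; have zC : z \in C by rewrite -(component_closed CP exz) (valP x).
by apply: connect_trans (IH (Sub z zC) zc yE); apply: connect1.
Qed.

Lemma sum_components w :
  \sum_z w z = \sum_(C in P) \sum_(x : {x | x \in C}) restrict C w x.
Proof.
under [RHS]eq_bigr => C _ do rewrite -(big_sub C w).
rewrite -(set_partition_big _ components_partition).
by apply: eq_bigl => z; rewrite inE.
Qed.

Lemma matched_extend C s q : matched (induced e C) s q -> matched e s (extend q).
Proof.
elim=> [{}q q0|{}s {}q q' x y exy _ IH q'E].
  by apply: Matched0 => z; rewrite /extend; case: insubP => //= x _ _; apply: q0.
apply: (@MatchedS _ e _ _ _ (val x) (val y) exy IH) => z; have [zC|zC] := boolP (z \in C).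
  by have := q'E (Sub z zC); rewrite -!extend_val.
rewrite !extend_out //; case: eqP => [zx|_]; first by rewrite zx (valP x) in zC.
by case: eqP => // zy; rewrite zy (valP y) in zC.
Qed.

Lemma matched_restrict r q : matched e r q ->
  exists2 r_ : {set T} -> nat, r = \sum_(C in P) r_ C &
    forall C, C \in P -> matched (induced e C) (r_ C) (restrict C q).
Proof.
elim=> [{}q q0|{}r {}q q' x y exy _ [r_ -> IH] q'E].
  exists (fun=> 0); first by rewrite big1.
  by move=> C _; apply: Matched0 => z; apply: q0.
exists (fun C => (C == pblock P x) + r_ C).
  by rewrite big_split /= sum_vertex component_mem.
move=> C CP; have [CE|CE] := eqVneq C (pblock P x).
  have xC : x \in C by rewrite CE mem_component.
  have yC : y \in C by rewrite -(component_closed CP exy).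
  apply: (@MatchedS _ (induced e C) _ _ _ (Sub x xC) (Sub y yC)) (IH C CP) _ => //.
  by move=> z; apply: q'E.
have xC : x \notin C by apply: contra CE => xC; rewrite (componentE CP xC).
have yC : y \notin C by rewrite -(component_closed CP exy).
apply: matched_ext (IH C CP) => z; rewrite /restrict q'E.
case: eqP => [zx|_]; first by rewrite -zx (valP z) in xC.
by case: eqP => [zy|_]; [rewrite -zy (valP z) in yC | rewrite !addn0].
Qed.

(** A multiset of edges splits according to the components, and multisets of edges
    in the components can be put together. *)
Lemma nu_components m : nu e m = \sum_(C in P) nu (induced e C) (restrict C m).
Proof.
apply/eqP; rewrite eqn_leq; apply/andP; split.
  have [q qm qle] : packing e (nu e m) m by apply/nuP.
  have [r_ -> r_P] := matched_restrict qm; apply: leq_sum => C CP.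
  by apply/nuP; exists (restrict C q) => [|x]; [apply: r_P | apply: qle].
apply/nuP; rewrite -big_enum /=.
have packL (L : seq {set T}) :
    packing e (\sum_(C <- L) nu (induced e C) (restrict C m))
      (fun z => \sum_(C <- L) (z \in C) * m z).
  elim: L => [|C L IH]; first by rewrite big_nil; apply: packing0.
  rewrite big_cons; have [q qm qle] : packing (induced e C)
      (nu (induced e C) (restrict C m)) (restrict C m) by apply/nuP.
  have CP : packing e (nu (induced e C) (restrict C m)) (fun z => (z \in C) * m z).
    exists (extend q); first exact: matched_extend.
    move=> z; have [zC|zC] := boolP (z \in C); last by rewrite extend_out.
    by rewrite mul1n; have := qle (Sub z zC); rewrite -extend_val.
  by apply: packing_mono (packingD CP IH) => z; rewrite big_cons.
apply: packing_mono (packL _) => z; rewrite big_enum /=.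
rewrite (bigD1 (pblock P z)) ?component_mem //= mem_component mul1n big1 ?addn0 //.
move=> C /andP[CP CE]; case: (boolP (z \in C)) => // zC.
by rewrite (componentE CP zC) eqxx in CE.
Qed.

Lemma nu_lt_components m w :
  nu e m < nu e (fun z => m z + w z) <->
  exists2 C, C \in P & nu (induced e C) (restrict C m)
    < nu (induced e C) (fun x => restrict C m x + restrict C w x).
Proof.
rewrite !nu_components; split=> [lt|[C CP lt]].
  apply: contrapT => no_C; move: lt; apply/negP; rewrite -leqNgt.
  apply: leq_sum => C CP; rewrite leqNgt; apply/negP => lt; apply: no_C.
  by exists C.
apply: (ltn_sum_in CP lt) => C' _; apply: nu_mono => x.
exact: leq_addr.
Qed.

(** Only the components met by [w] can gain edges from [w]. Conversely the union
    of the vertex sets of the components works for the whole graph; they are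
    chosen here as subsets of [T] because the vertex types of the induced graphs
    depend on the component. *)
Lemma prime_colon_components m : prime_colon e (nu e m) m <->
  forall C, C \in P ->
    prime_colon (induced e C) (nu (induced e C) (restrict C m)) (restrict C m).
Proof.
split=> [/prime_colon_nuP[U mU] C CP|mC].
  apply/prime_colon_nuP; exists [set x | val x \in U] => w.
  have restrict_ext : restrict C (extend w) = w.
    by apply/funext => x; apply: extend_val.
  split=> [lt|[x]].
    have /mU[z zU] : nu e m < nu e (fun z => m z + extend w z).
      by apply/nu_lt_components; exists C; rewrite // restrict_ext.
    have [zC wz|zC] := boolP (z \in C); last by rewrite extend_out.
    by exists (Sub z zC); rewrite ?inE // -extend_val.
  rewrite inE => xU wx.
  have /nu_lt_components[C' C'P] : nu e m < nu e (fun z => m z + extend w z).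
    by apply/mU; exists (val x); rewrite ?extend_val.
  have [->|C'C] := eqVneq C' C; first by rewrite restrict_ext.
  rewrite (_ : (fun x => _) = restrict C' m) ?ltnn //; apply/funext => z.
  rewrite /restrict extend_out ?addn0 //; apply: contra C'C => zC.
  by rewrite -(componentE CP zC) (componentE C'P (valP z)).
have /boolp.choice[V VP] C : exists V : {set T}, C \in P ->
    forall v : {x | x \in C} -> nat,
    nu (induced e C) (restrict C m) < nu (induced e C) (fun x => restrict C m x + v x)
      <-> exists2 x, val x \in V & 0 < v x.
  have [CP|_] := boolP (C \in P); last by exists set0.
  have /prime_colon_nuP[U UP] := mC C CP; exists (val @: U) => _ v; rewrite UP.
  by split=> -[x xU wx]; exists x => //; move: xU; rewrite mem_imset //; apply: val_inj.
apply/prime_colon_nuP; exists [set x | x \in V (pblock P x)] => w.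
split=> [/nu_lt_components[C CP /(VP C CP)[x xV wx]]|[x]].
  by exists (val x); rewrite // inE (componentE CP (valP x)).
rewrite inE => xV wx; apply/nu_lt_components.
exists (pblock P x); first exact: component_mem.
apply/(VP _ (component_mem x)).
by exists (Sub x (mem_component x)).
Qed.

Lemma prime_colon_components_size m :
  (forall C, C \in P ->
    prime_colon (induced e C) (nu (induced e C) (restrict C m)) (restrict C m)) ->
  (nu e m).*2 + #|P| <= \sum_z m z ?= iff
  [forall C in P, \sum_x restrict C m x
     == (nu (induced e C) (restrict C m)).*2 + 1].
Proof.
move=> mP; rewrite sum_components nu_components -!muln2 big_distrl /=.
rewrite -sum1_card -big_split /=.
rewrite [X in _ <= _ ?= iff X](_ : _ = [forall C in P,
   nu (induced e C) (restrict C m) * 2 + 1 == \sum_x restrict C m x]); last first.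
  by apply: eq_forallb => C; rewrite eq_sym muln2.
apply: leqif_sum => C CP; apply/leqifP.
have lt := prime_colon_size (mP C CP) (component_edge CP).
case: eqP => // /eqP ne; rewrite ltn_neqAle ne addn1 muln2.
exact: lt.
Qed.

Lemma prime_colon_min s m : prime_colon e s m -> (exists x y, e x y) ->
  s.*2 + #|P| <= \sum_z m z.
Proof.
move=> sm eT; have sE := prime_colon_nu e_sym sm eT; subst s.
by have /prime_colon_components /prime_colon_components_size [] := sm.
Qed.

(** A component is connected with an edge, so its set of tight indices is nonempty
    and closed under successor. *)
Lemma tight_component C : C \in P ->
  exists s0, forall s, tight (induced e C) 1 s <-> s0 <= s.
Proof.
move=> CP; have eC := component_edge CP.
have sC : ssrbool.symmetric (induced e C) by move=> x y; apply: e_sym.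
have iC : irreflexive (induced e C) by move=> x; apply: e_irr.
have [s1 tight1] : exists s, tight (induced e C) 1 s.
  have [s [m [sm mE]]] := prime_colon_exists sC (induced_connect CP) eC.
  by exists s, m; split => //; rewrite mE addn1.
have [tight0 _] := natminP tight1.
exists (natmin (tight (induced e C) 1)) => s; split=> [ts|].
  by have [] := natminP ts.
move=> /subnK <-; elim: (s - _) => [//|d [m [dm mE]]].
have [|m' [dm' m'E]] := prime_colon_succ sC iC dm eC; first by rewrite mE addn1.
by exists m'; split => //; rewrite m'E addn1.
Qed.

(** If [2s + c] is attained, so are the bounds [2s_i + 1] of the components, as
    they add up to it. Conversely a surplus over the sum of the thresholds can be
    put on a single component. *)
Lemma tight_sum (s0 : {set T} -> nat) s : (exists x y, e x y) ->
  (forall C, C \in P -> forall s, tight (induced e C) 1 s <-> s0 C <= s) ->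
  tight e #|P| s <-> \sum_(C in P) s0 C <= s.
Proof.
move=> eT s0P; split=> [[m [sm mE]]|].
  have sE := prime_colon_nu e_sym sm eT; subst s; have /prime_colon_components mC := sm.
  have [_ ] := prime_colon_components_size mC; rewrite mE eqxx => /esym /forall_inP mCE.
  rewrite nu_components; apply: leq_sum => C CP; apply/(s0P C CP).
  by exists (restrict C m); split; [apply: mC | apply/eqP/mCE].
move=> /subnKC; set d := s - _ => <-.
have [x [_ _]] := eT; pose s' C := s0 C + d * (C == pblock P x).
have /boolp.choice[M MP] C : exists m : T -> nat, C \in P ->
    prime_colon (induced e C) (s' C) (restrict C m)
      /\ \sum_x restrict C m x = (s' C).*2 + 1.
  have [CP|_] := boolP (C \in P); last by exists (fun=> 0).
  have [|m mE] := (s0P C CP (s' C)).2; first exact: leq_addr.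
  exists (extend m) => _; rewrite (_ : restrict C (extend m) = m) //.
  by apply/funext => z; apply: extend_val.
pose m z := M (pblock P z) z.
have mM C : C \in P -> restrict C m = restrict C (M C).
  by move=> CP; apply/funext => z; rewrite /restrict /m (componentE CP (valP z)).
have nuC C : C \in P -> nu (induced e C) (restrict C m) = s' C.
  move=> CP; rewrite mM //; have [gC _] := MP C CP.
  by apply: prime_colon_nu gC (component_edge CP) => a b; apply: e_sym.
have nuE : nu e m = \sum_(C in P) s0 C + d.
  rewrite nu_components (eq_bigr s') // /s' big_split /= -big_distrr /=.
  by rewrite sum_vertex component_mem muln1.
have mC C : C \in P ->
    prime_colon (induced e C) (nu (induced e C) (restrict C m)) (restrict C m).
  by move=> CP; rewrite nuC // mM //; case: (MP C CP).
exists m; rewrite -nuE; split; first exact/prime_colon_components.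
apply/esym/eqP; rewrite (prime_colon_components_size mC).2.
by apply/forall_inP => C CP; rewrite nuC // mM // (MP C CP).2.
Qed.

End Components.

(** * The v-number and its stability index *)

Section VNumber.
Variables (k : fieldType) (T : finType) (e : rel T).
Local Notation I := (edge_ideal k e).

(** Positivity of [d] tells a minimum equal to [d] from the default value of an
    empty minimum. *)
Lemma v_number_eq s d : 0 < d -> (forall m, prime_colon e s m -> d <= \sum_z m z) ->
  v_number (ideal_exp I s.+1) = d <-> exists m, prime_colon e s m /\ \sum_z m z = d.
Proof.
move=> d0 dmin; have local_min P f : prime_ideal P ->
    colon (ideal_exp I s.+1) f =i P -> d <= (msize f).-1.
  by move=> Pp fP; have [w /dmin dw] := colon_prime_term Pp fP; apply: leq_trans.
split=> [|[m [[U mU] mE]]].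
  move=> /(natmin_pos d0)[P [Pp _] /esym /(natmin_pos d0)[f fP dE]].
  have [w ws wE] := colon_prime_term Pp fP; exists w; split => //.
  by apply/eqP; rewrite eqn_leq dmin // dE wE.
have colonE := colon_vmon (k := k) mU; have Pp := hit_ideal_prime k U.
have assoc : associated_prime (ideal_exp I s.+1) (hit_ideal U).
  by split => //; exists 'X_[vmon m].
have size_m : d = (msize ('X_[vmon m] : {mpoly k[#|T|]})).-1.
  by rewrite msizeX vmon_mdeg mE.
have localE : local_v_number (ideal_exp I s.+1) (hit_ideal U) = d.
  apply: natmin_eq => [|n [f fP ->]]; first by exists 'X_[vmon m].
  exact: local_min fP.
apply: natmin_eq => [|n [P [Pp' [f fP]] ->]]; first by exists (hit_ideal U).
pose A n := exists2 g : {mpoly k[#|T|]},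
  colon (ideal_exp I s.+1) g =i P & n = (msize g).-1.
have Af : A (msize f).-1 by exists f.
have [[g gP gE] _] := natminP Af.
by rewrite (_ : local_v_number _ _ = natmin A) // gE; apply: local_min gP.
Qed.

(** From [s0 + 1] on the v-number is [2t + c - 2]. If it is linear from [n] on, it
    agrees with this line at two large arguments, hence already at [n], so
    [n - 1] is tight. *)
Lemma vstab_tight c s0 : 0 < c ->
  (forall s m, prime_colon e s m -> s.*2 + c <= \sum_z m z) ->
  (forall s, tight e c s <-> s0 <= s) -> vstab I = s0.+1.
Proof.
move=> c0 cmin cs0.
have vP s : v_number (ideal_exp I s.+1) = s.*2 + c <-> s0 <= s.
  by rewrite v_number_eq; [apply: cs0 | lia | apply: cmin].
apply: natmin_eq => [|n [n0 [a [b nlin]]]].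
  split=> //; exists 2%Z, (c%:Z - 2)%R => -[//|t] /vP ->; lia.
case: n n0 nlin => // n _ nlin; rewrite ltnS; apply/vP.
have v1 := (vP (s0 + n)).2 (leq_addr _ _).
have v2 := (vP (s0 + n).+1).2 (leq_trans (leq_addr _ _) (leqnSn _)).
have := nlin (s0 + n).+1; have := nlin (s0 + n).+2; have := nlin n.+1.
rewrite v1 v2 => /(_ (leqnn _)) nE /(_ _) H2 /(_ _) H1.
have {}H2 := H2 ltac:(lia); have {}H1 := H1 ltac:(lia).
have a2 : a = 2%Z by nia.
by subst a; lia.
Qed.

(** All positive powers of the zero ideal coincide. *)
Lemma vstab_edgeless : (forall x y, ~~ e x y) -> vstab I = 1.
Proof.
move=> e0; apply: natmin_eq => [|n []//]; split=> //.
exists 0%R, (v_number (ideal_exp I 1))%:Z%R => -[//|t] _.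
suff -> : ideal_exp I t.+1 = ideal_exp I 1 by lia.
have no_packing s m : ~ packing e s.+1 m.
  case=> q; move Es: s.+1 => s' sq; case: sq Es => // s1 p q1 x y.
  by rewrite (negPf (e0 x y)).
apply/funext => f; change ((f \in ideal_exp I t.+1) = (f \in ideal_exp I 1)).
by apply/edge_ideal_expP/edge_ideal_expP => fP m /fP /no_packing.
Qed.

End VNumber.

(** * Additivity of the stability index *)

Import GRing.Theory.
Local Open Scope ring_scope.

Theorem theorem1p3 (k : fieldType) (T : finType) (e : rel T)
    (e_sym : ssrbool.symmetric e) (e_irr : irreflexive e)
    (no_isolated : forall x : T, exists y : T, e x y) :
  (vstab (edge_ideal k e))%:Z =
    (\sum_(C in components e) (vstab (edge_ideal k (induced e C)))%:Z)
      - (#|components e|)%:Z + 1.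
Proof.
(* Without vertices [c = 0], and the bound [2s + c] is [0] at [s = 0], like the
   default value of a minimum; there the powers are compared directly. *)
have [[x0 _]|T0] := pselect (exists x : T, True); last first.
  have T_empty (x : T) : False by apply: T0; exists x.
  rewrite vstab_edgeless => [|x]; last by case: (T_empty x).
  have -> : components e = finset.set0.
    by apply/setP => C; rewrite inE; apply/negP => /imsetP[x]; case: (T_empty x).
  by rewrite big_set0 cards0.
have eT : exists x y, e x y by exists x0.
have /boolp.choice[s0 s0P] C : exists s0 : nat, C \in components e ->
    forall s, tight (induced e C) 1 s <-> (s0 <= s)%N.
  have [CP|_] := boolP (C \in components e); last by exists 0%N.
  by have [s0 ?] := tight_component e_sym e_irr no_isolated CP; exists s0.
have vC C : C \in components e -> vstab (edge_ideal k (induced e C)) = (s0 C).+1.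
  move=> CP; apply: (vstab_tight k (c := 1)) => //; last exact: s0P.
  move=> s m sm; rewrite addn1.
  exact: prime_colon_size sm (component_edge e_sym no_isolated CP).
rewrite (vstab_tight k (c := #|components e|) (s0 := (\sum_(C in components e) s0 C)%N)).
- rewrite (eq_bigr (fun C => (s0 C)%:Z + 1)) => [|C CP]; last first.
    by rewrite -(PoszD _ 1) addn1 -(vC C CP).
  rewrite -addn1 PoszD (big_morph Posz PoszD (erefl _)).
  by rewrite big_split /= sumr_const natz addrK.
- rewrite card_gt0; apply/set0Pn; exists (pblock (components e) x0).
  exact: component_mem.
- by move=> s m sm; apply: prime_colon_min sm eT.
- by move=> s; apply: tight_sum.
Qed.
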